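(* Let $(X,\leq_X)$ be a countable linear order. Then $L_{(X,\leq_X)}=\{y\in X^\omega: (\exists k_0<k_1<\ldots)(\forall i\in\omega)(y(k_i)\leq_X y(k_{i+1}))\}$ is a $\mathbf{\Sigma}_1^1$-complete subset of $X^\omega$ if and only if $X$ contains a $\leq_X$-dense subset.
   Context: Here $\omega$ is the set of natural numbers (including $0$), and $k_0<k_1<\ldots$ ranges over strictly increasing sequences of elements of $\omega$. The space $X^\omega$ carries the product topology with the countable set $X$ discrete. A subset $D\subseteq X$ is called $\leq_X$-dense if it has at least two elements and is densely ordered by $\leq_X$, i.e. for all $a,b\in D$ with $a<_X b$ there is $c\in D$ with $a<_X c<_X b$. A subset $A$ of a Polish space $\mathcal{X}$ is $\mathbf{\Sigma}_1^1$-complete if $A$ is analytic and for every Polish space $\mathcal{Y}$ and every analytic $B\subseteq\mathcal{Y}$ there is a Borel map $f:\mathcal{Y}\to\mathcal{X}$ such that $f^{-1}(A)=B$. *)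

(* Defs.v *)
From mathcomp Require Import all_boot all_order all_algebra.
From mathcomp Require Import all_classical all_reals all_analysis.

Set Implicit Arguments.
Unset Strict Implicit.
Unset Printing Implicit Defensive.

Local Open Scope classical_set_scope.

Definition homeomorphic (S T : topologicalType) : Prop :=
  exists (f : S -> T) (g : T -> S),
    [/\ cancel f g, cancel g f, continuous f & continuous g].

Definition separable (T : topologicalType) : Prop :=
  exists2 D : set T, countable D & dense D.

(* The library's [completeType] is pointed; completeness is restated here
   without that restriction, since an empty space is Polish. *)
Definition complete_metric (R : realType) (M : metricType R) : Prop :=
  forall F : set_system M, ProperFilter F -> cauchy F -> exists x : M, F --> x.

(* [R] only serves as the field in which the metric takes its values. *)
Definition polish (R : realType) (T : topologicalType) : Prop :=
  separable T /\
  exists2 M : metricType R, complete_metric M & homeomorphic T M.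

Definition analytic (R : realType) (T : topologicalType) (A : set T) : Prop :=
  exists Z : topologicalType, polish R Z /\
    exists2 g : Z -> T, continuous g & range g = A.

Definition borel (T : topologicalType) : set_system T := <<s @open T >>.

Definition borel_map (S T : topologicalType) (f : S -> T) : Prop :=
  forall B : set T, borel B -> borel (f @^-1` B).

Definition Sigma11_complete (R : realType) (T : topologicalType) (A : set T) :
    Prop :=
  analytic R A /\
  forall Y : topologicalType, polish R Y ->
  forall B : set Y, analytic R B ->
  exists2 f : Y -> T, borel_map f & f @^-1` A = B.

Definition seq_space (X : choiceType) : topologicalType :=
  {ptws nat -> discrete_topology X}.

Definition L d (X : orderType d) : set (seq_space X) :=
  [set y : nat -> X | exists2 k : nat -> nat,
    (forall i, (k i < k i.+1)%N) & (forall i, (y (k i) <= y (k i.+1))%O)].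
Arguments L {d} X.

(* Unrelated to the topological [dense]. *)
Definition order_dense d (X : orderType d) (D : set X) : Prop :=
  (exists a b : X, [/\ D a, D b & a <> b]) /\
  (forall a b : X, D a -> D b -> (a < b)%O ->
     exists2 c : X, D c & (a < c < b)%O).

(* Main.v *)
(* If [X] contains a dense subset, the tree of finite sequences of naturals maps
   to intervals of that subset so that the children of a node lie inside it and
   move to the left; an infinite nondecreasing run of left endpoints then forces
   an infinite branch.  Any analytic set is obtained from closed sets by the
   Suslin operation, that is, as the set of points whose tree has an infinite
   branch, and so reduces to [L X].

   Conversely, call [x] and [y] equivalent when the sequences with a
   nondecreasing subsequence in [A] form a Borel set for every subset [A] of the
   interval between [x] and [y].  Two adjacent classes would merge, so
   representatives of the classes form a dense subset unless there is only one
   class, in which case [L X] is Borel.  But if a complete set were Borel, so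
   would be [L rat], and with it, by the first part, every set obtained from
   closed sets by the Suslin operation; a diagonal argument refutes this. *)
Require Import Defs.
From HB Require Import structures.
From mathcomp Require Import all_boot all_order all_algebra.
From mathcomp Require Import all_classical all_reals all_analysis.
From mathcomp Require Import lra.

Local Open Scope classical_set_scope.

Set Implicit Arguments.
Unset Strict Implicit.
Unset Printing Implicit Defensive.

Import Order.TTheory GRing.Theory Num.Theory.

(** * Countable types and Borel sets *)

Lemma countable_inj (T : Type) :
  countable [set: T] -> exists f : T -> nat, injective f.
Proof. by move/countable_injP => [f fi]; exists f => x y; apply: fi; rewrite inE. Qed.

Lemma inj_countable (T : Type) (C : countType) (f : T -> C) :
  injective f -> countable [set: T].
Proof.
move=> fi; apply/countable_injP; exists (pickle \o f) => x y _ _ /= /(pcan_inj pickleK).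
exact: fi.
Qed.

Section Borel.
Variable T : topologicalType.
Implicit Types A B : set T.

Lemma borel_sigma_algebra : sigma_algebra setT (borel (T := T)).
Proof. exact: smallest_sigma_algebra. Qed.

Lemma borel_open A : open A -> borel A.
Proof. by move=> oA; apply: sub_sigma_algebra. Qed.

Lemma borelC A : borel A -> borel (~` A).
Proof. by rewrite -setTD; case: borel_sigma_algebra => _ + _; apply. Qed.

Lemma borel_closed A : closed A -> borel A.
Proof. by rewrite -openC -{2}(setCK A) => /borel_open; exact: borelC. Qed.

Lemma borel0 : borel (set0 : set T).
Proof. by case: borel_sigma_algebra. Qed.

Lemma borelT : borel [set: T].
Proof. by rewrite -setC0; apply: borelC; exact: borel0. Qed.

Lemma borel_bigcup (I : Type) (F : I -> set T) : countable [set: I] ->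
  (forall i, borel (F i)) -> borel (\bigcup_i F i).
Proof.
move=> /countable_inj[f fi] bF.
(* Regrouping along the injection into [nat] gives a union over [nat], each group having at most one
   member. *)
have -> : \bigcup_i F i = \bigcup_n \bigcup_(i in [set i | f i = n]) F i.
  apply/seteqP; split=> [x [i _ Fx]|x [n _ [i _ Fx]]]; last by exists i.
  by exists (f i) => //; exists i.
case: borel_sigma_algebra => b0 _; apply => n.
have [[i <-]|nf] := pselect (exists i, f i = n).
  rewrite (_ : [set _ | _] = [set i]) ?bigcup_set1//.
  by apply/seteqP; split=> j /= => [/fi|->].
rewrite (_ : [set _ | _] = set0) ?bigcup_set0//.
by apply/seteqP; split=> j //= fj; apply: nf; exists j.
Qed.

Lemma borel_bigcap (I : Type) (F : I -> set T) : countable [set: I] ->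
  (forall i, borel (F i)) -> borel (\bigcap_i F i).
Proof.
move=> cI bF; rewrite -[X in borel X]setCK setC_bigcap; apply: borelC.
by apply: borel_bigcup => // i; exact: borelC.
Qed.

Lemma borelU A B : borel A -> borel B -> borel (A `|` B).
Proof.
move=> bA bB; rewrite -bigcup2E.
by apply: borel_bigcup => // -[|[|n]] //=; exact: borel0.
Qed.

Lemma borelI A B : borel A -> borel B -> borel (A `&` B).
Proof.
move=> bA bB; rewrite -[X in borel X]setCK setCI.
by apply: borelC; apply: borelU; exact: borelC.
Qed.

End Borel.

(** * Topology and Borel maps of sequence spaces *)

Definition agree (X : Type) (n : nat) (x y : nat -> X) :=
  forall i, (i < n)%N -> x i = y i.

Section SeqSpace.
Variable X : choiceType.
Implicit Types (x y : seq_space X) (A : set (seq_space X)).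

Lemma nbhs_seq_spaceP x A :
  nbhs x A <-> exists n, forall y, agree n x y -> A y.
Proof.
split=> [nA|[n nA]].
  (* The sets containing a cylinder at [x] form a filter. The product topology being a supremum, its
     convergence to [x] is checked one coordinate at a time. *)
  pose F : set_system (seq_space X) :=
    [set B | exists n, forall y, agree n x y -> B y].
  have FF : Filter F.
    split=> [|B C [n nB] [m mC]|B C BC [n nB]]; first by exists 0.
    - exists (maxn n m) => y xy; split; [apply: nB|apply: mC] => i im;
        by apply: xy; rewrite leq_max im ?orbT.
    - by exists n => y /nB/BC.
  suff : F --> x by move=> /(_ A nA).
  apply/cvg_sup => i U [V] [[W] oW <-] Wx WU.
  exists i.+1 => y xy; apply: WU; rewrite /= /proj.
  by rewrite -(xy i)//; exact: Wx.
suff : nbhs x [set y : seq_space X | agree n x y] by apply: filterS.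
elim: n {nA} => [|n IHn].
  rewrite (_ : [set _ | _] = setT); first exact: filterT.
  by apply/seteqP; split => // y _ i.
have pn : nbhs x (proj n @^-1` [set x n] : set (seq_space X)).
  apply: (@proj_continuous nat (fun=> discrete_topology X) n x).
  exact: (@discrete_set1 (discrete_topology X)).
apply: filterS (filterI IHn pn) => y [xy yn] i.
by rewrite ltnS leq_eqVlt => /orP[/eqP ->|/xy].
Qed.

Lemma open_seq_spaceP A :
  open A <-> forall x, A x -> exists n, forall y, agree n x y -> A y.
Proof. by rewrite openE; split=> oA x Ax; apply/nbhs_seq_spaceP/oA. Qed.

End SeqSpace.

Lemma continuous_seq_space (X Y : choiceType) (f : seq_space X -> seq_space Y) :
  (forall x n, exists m, forall y, agree m x y -> f x n = f y n) -> continuous f.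
Proof.
move=> fc x A /nbhs_seq_spaceP[n nA]; apply/nbhs_seq_spaceP.
suff [m mn] : exists m, forall y, agree m x y -> agree n (f x) (f y).
  by exists m => y /mn/nA.
elim: n {A nA} => [|n [m IHm]]; first by exists 0.
have [k kn] := fc x n.
exists (maxn m k) => y xy i; rewrite ltnS leq_eqVlt => /orP[/eqP ->|].
  by apply: kn => j jk; apply: xy; rewrite leq_max jk orbT.
by apply: IHm => j jm; apply: xy; rewrite leq_max jm.
Qed.

Lemma countable_seq (X : Type) : countable [set: X] -> countable [set: seq X].
Proof. by move=> /countable_inj[f fi]; exact/inj_countable/(inj_map fi). Qed.

Lemma countable_prod (X Y : Type) : countable [set: X] -> countable [set: Y] ->
  countable [set: X * Y].
Proof. by move=> cX cY; rewrite -setXTT; exact: countableX. Qed.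

(** For countable [X] every open set is a countable union of cylinders, and a cylinder restricts
    only finitely many coordinates. *)
Lemma borel_map_seq_space (Y : topologicalType) (X : choiceType)
    (f : Y -> seq_space X) : countable [set: X] ->
  (forall n a, borel [set y | f y n = a]) -> borel_map f.
Proof.
move=> cX bf; apply: smallest_sub => [|U /open_seq_spaceP oU].
  split=> [|A bA|F bF]; first exact: borel0.
  - by rewrite /= setTD preimage_setC; exact: borelC.
  - by rewrite /= preimage_bigcup; exact: borel_bigcup.
have bcyl n (x : nat -> X) : borel [set y | agree n x (f y)].
  rewrite (_ : [set _ | _] = \bigcap_i [set y | (i < n)%N -> x i = f y i]).
    apply: borel_bigcap => // i; have [ltin|gein] := boolP (i < n)%N.
      rewrite (_ : [set _ | _] = [set y | f y i = x i]) //.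
      by apply/seteqP; split => y /= => [/(_ isT)|->].
    rewrite (_ : [set _ | _] = setT); first exact: borelT.
    by apply/seteqP; split => y.
  by apply/seteqP; split => y yP i => [_|]; apply: yP.
pose C (t : seq X) := [set y | mkseq (f y) (size t) = t /\
  forall x, mkseq x (size t) = t -> U x].
rewrite (_ : f @^-1` U = \bigcup_t C t); last first.
  apply/seteqP; split => y; last by move=> [t _ [yt]]; apply.
  move=> /oU[n nU]; exists (mkseq (f y) n) => //; split; rewrite size_mkseq// => x.
  move=> xy; apply: nU => i ltin.
  by have /(congr1 (nth (f y i) ^~ i)) := xy; rewrite !nth_mkseq.
apply: borel_bigcup; first exact: countable_seq.
(* No such [x] exists only when both [t] and [X] are empty. *)
move=> t; have [[x xt]|nx] := pselect (exists x, mkseq x (size t) = t); last first.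
  rewrite (_ : C t = set0); first exact: borel0.
  by rewrite -subset0 => y [yt _]; apply: nx; exists (f y).
have [tU|ntU] := pselect (forall x, mkseq x (size t) = t -> U x); last first.
  by rewrite (_ : C t = set0); [exact: borel0|rewrite -subset0 => y []].
rewrite (_ : C t = [set y | agree (size t) x (f y)]) //.
apply/seteqP; split=> y; rewrite /C/=.
  move=> [yt _] i ltit; move: yt; rewrite -{2}xt.
  by move/(congr1 (nth (x i) ^~ i)); rewrite !nth_mkseq.
move=> xy; split => //; rewrite -[RHS]xt; apply/eq_in_map => i.
by rewrite mem_iota/= => /xy.
Qed.

(** * Sequence spaces are Polish *)

Section FirstDifference.
Variables (R : realType) (X : choiceType).
Implicit Types x y z : nat -> X.
Local Open Scope ring_scope.

Definition first_diff_dist x y : R :=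
  if pselect (exists n, x n != y n) is left ex then (ex_minn ex).+1%:R^-1 else 0.

Lemma first_diff_dist_ge0 x y : 0 <= first_diff_dist x y.
Proof. by rewrite /first_diff_dist; case: pselect. Qed.

Lemma first_diff_dist_lt n x y :
  first_diff_dist x y < n.+1%:R^-1 <-> agree n.+1 x y.
Proof.
rewrite /first_diff_dist; case: pselect => [ex|nex]; last first.
  rewrite invr_gt0 ltr0n; split=> // _ i _.
  by apply/eqP/negPn/negP => xy; apply: nex; exists i.
case: ex_minnP => m xym mmin; rewrite ltf_pV2 ?posrE// ltr_nat; split.
  rewrite ltnS => nm i /leq_trans/(_ nm) im.
  by apply: contraTeq im => /mmin; rewrite -leqNgt.
move=> xy; rewrite ltnS ltnNge; apply: contra xym => mn.
by rewrite xy.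
Qed.

Lemma first_diff_dist_ge n x y :
  x n <> y n -> n.+1%:R^-1 <= first_diff_dist x y.
Proof. by move=> xy; rewrite leNgt; apply/negP => /first_diff_dist_lt/(_ n (ltnSn n)). Qed.

Lemma first_diff_dist_xx x : first_diff_dist x x = 0.
Proof.
by rewrite /first_diff_dist; case: pselect => // ex; have [n] := ex; rewrite eqxx.
Qed.

Lemma first_diff_dist_eq0 x y : first_diff_dist x y = 0 -> x = y.
Proof.
move=> d0; apply/funext => n; apply: contrapT => /first_diff_dist_ge.
by rewrite d0 leNgt invr_gt0 ltr0n.
Qed.

Lemma first_diff_dist_sym x y : first_diff_dist x y = first_diff_dist y x.
Proof.
rewrite /first_diff_dist; case: pselect => [ex|nex]; case: pselect => [ex'|nex'] //.
- congr (_.+1%:R^-1); case: ex_minnP => m xym mmin; case: ex_minnP => k xyk kmin.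
  by apply/eqP; rewrite eqn_leq mmin 1?eq_sym// kmin// eq_sym.
- by case: nex'; case: ex => n xyn; exists n; rewrite eq_sym.
- by case: nex; case: ex' => n xyn; exists n; rewrite eq_sym.
Qed.

(** Where [x] and [z] first differ, [y] differs from one of them, so one summand alone is large
    enough. *)
Lemma first_diff_dist_triangle y x z :
  first_diff_dist x z <= first_diff_dist x y + first_diff_dist y z.
Proof.
rewrite {1}/first_diff_dist; case: pselect => [ex|nex]; last first.
  by rewrite addr_ge0// first_diff_dist_ge0.
case: ex_minnP => m xzm _; have [xym|xym] := eqVneq (x m) (y m).
  apply: ler_wpDl; first exact: first_diff_dist_ge0.
  by apply: first_diff_dist_ge => yzm; move: xzm; rewrite xym yzm eqxx.
apply: ler_wpDr; first exact: first_diff_dist_ge0.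
exact/first_diff_dist_ge/eqP.
Qed.

End FirstDifference.

(** A second name for the sequences keeps the topology of the metric apart from that of [seq_space];
    [nbhs_seq_spaceP] and [nbhs_first_diffP] show that the two agree. *)
Definition first_diff_space (R : realType) (X : choiceType) : Type := nat -> X.
HB.instance Definition _ (R : realType) (X : choiceType) :=
  Choice.copy (first_diff_space R X) (seq_space X).
HB.instance Definition _ (R : realType) (X : choiceType) :=
  isMetric.Build R (first_diff_space R X) (@first_diff_dist_xx R X)
    (@first_diff_dist_eq0 R X) (@first_diff_dist_sym R X)
    (@first_diff_dist_triangle R X).

Lemma inv_nat_lt (R : realType) (e : R) : (0 < e)%R ->
  exists n, (n.+1%:R^-1 < e)%R.
Proof.
move=> e0.
by have [n _ /(_ n (leqnn n))/= ne] := near_infty_natSinv_lt (PosNum e0); exists n.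
Qed.

Section PolishSeqSpace.
Variables (R : realType) (X : choiceType).
Local Notation M := (first_diff_space R X : metricType R).

Lemma ball_first_diff n (x y : M) :
  ball x (n.+1%:R^-1 : R)%R y <-> agree n.+1 x y.
Proof. by rewrite ballEmdist; exact: first_diff_dist_lt. Qed.

Lemma ball_first_diff_sub (x : M) (e : R) : (0 < e)%R ->
  exists n, forall y, agree n x y -> ball x e y.
Proof.
move=> /inv_nat_lt[n ne].
by exists n.+1 => y /ball_first_diff; exact/le_ball/ltW.
Qed.

Lemma nbhs_first_diffP (x : M) A :
  nbhs x A <-> exists n, forall y, agree n x y -> A y.
Proof.
split=> [/nbhs_ballP[e /= e0 eA]|[n nA]].
  by have [n xn] := ball_first_diff_sub x e0; exists n => y /xn/eA.
apply/nbhs_ballP; exists (n.+1%:R^-1)%R; first by rewrite /= invr_gt0.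
by move=> y /ball_first_diff xy; apply: nA => i /ltnW; exact: xy.
Qed.

(** A ball of index [n] in the filter fixes the coordinates up to [n], so the limit is the diagonal
    of the centers. *)
Lemma complete_first_diff : complete_metric M.
Proof.
move=> F FF /cauchyP cF.
have /choice[u Fu] n : exists x : M, F (ball x (n.+1%:R^-1 : R)%R).
  by apply: cF; rewrite invr_gt0.
have agreeu i n : (i <= n)%N -> u n i = u i i.
  move=> leqin; have [y [/ball_first_diff ny /ball_first_diff iy]] :=
    filter_ex (filterI (Fu n) (Fu i)).
  by rewrite ny ?ltnS// iy.
exists (fun i => u i i) => A /nbhs_first_diffP[n nA].
apply: filterS (Fu n) => y /ball_first_diff uy; apply: nA => i ltin.
by rewrite -uy ?leqW// agreeu// ltnW.
Qed.

Lemma polish_seq_space : countable [set: X] -> polish R (seq_space X).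
Proof.
move=> cX; split; last first.
  exists M; first exact: complete_first_diff.
  by exists id, id; split=> // x A; [move=> /nbhs_first_diffP|move=> /nbhs_seq_spaceP];
    [move/nbhs_seq_spaceP|move/nbhs_first_diffP].
(* The eventually constant sequences: the default value of [nth] continues the list. *)
exists (range (fun (s : X * seq X) (i : nat) => nth s.1 s.2 i)).
  apply: card_le_trans; first exact: card_image_le.
  by apply: countable_prod => //; exact: countable_seq.
move=> U [x Ux] /open_seq_spaceP/(_ x Ux)[n nU].
exists (fun i => nth (x 0) (mkseq x n) i); split.
  by apply: nU => i ltin; rewrite nth_mkseq.
by exists (x 0, mkseq x n).
Qed.

End PolishSeqSpace.

(** * [L X] is analytic *)

Section LAnalytic.
Variables (d : Order.disp_t) (X : orderType d).
Implicit Types (w : nat -> X * nat) (y : nat -> X).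

(** Coding positions by gaps makes every [w] a valid code, so the parametrization is defined on the
    whole sequence space. *)
Fixpoint gap_pos w (i : nat) : nat :=
  if i is j.+1 then (gap_pos w j + (w i).2).+1 else (w 0).2.

Fixpoint running_max w (i : nat) : X :=
  if i is j.+1 then Order.max (running_max w j) (w (gap_pos w i)).1
  else (w (gap_pos w 0)).1.

(* Every value of [raise_at_gaps] is in [L X]: along the positions coded by the
   gaps, the entries are replaced by their running maximum. *)
Definition raise_at_gaps (w : seq_space (X * nat)%type) : seq_space X :=
  fun n => if [pick i : 'I_n.+1 | gap_pos w i == n] is Some i
           then running_max w i else (w n).1.

Lemma gap_pos_lt w i : (gap_pos w i < gap_pos w i.+1)%N.
Proof. by rewrite /= ltnS leq_addr. Qed.

Lemma strict_mono_leq (k : nat -> nat) : (forall i, (k i < k i.+1)%N) ->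
  {mono k : i j / (i <= j)%N}.
Proof. by move=> kS; apply: leq_mono; exact: homo_ltn ltn_trans kS. Qed.

Lemma strict_mono_ge_id (k : nat -> nat) : (forall i, (k i < k i.+1)%N) ->
  forall i, (i <= k i)%N.
Proof. by move=> kS; elim=> // i /leq_ltn_trans; apply. Qed.

Lemma gap_pos_agree w w' i : agree i.+1 w w' -> gap_pos w i = gap_pos w' i.
Proof.
elim: i => [|i IHi] ww' /=; first by rewrite ww'.
by rewrite ww'// IHi// => j ji; apply: ww'; rewrite (ltn_trans ji).
Qed.

(** Computing the positions up to index [i] reads [w] only up to [i], and [i <= gap_pos w i]. *)
Lemma running_max_agree w w' i :
  agree (gap_pos w i).+1 w w' -> running_max w i = running_max w' i.
Proof.
have ipos := strict_mono_ge_id (gap_pos_lt w).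
have posE j : agree (gap_pos w j).+1 w w' -> gap_pos w j = gap_pos w' j.
  move=> ww'; apply: gap_pos_agree => k kj; apply: ww'.
  by rewrite ltnS (leq_trans _ (ipos j)).
elim: i => [|i IHi] ww'.
  by rewrite /running_max -posE// ww'.
rewrite /running_max -/running_max -posE// ww'// IHi// => j ji; apply: ww'.
exact/(ltn_trans ji)/gap_pos_lt.
Qed.

Lemma raise_at_gaps_continuous : continuous raise_at_gaps.
Proof.
apply: continuous_seq_space => w n; exists n.+1 => w' ww'.
have posE (i : 'I_n.+1) : gap_pos w i = gap_pos w' i.
  by apply: gap_pos_agree => j ji; apply: ww'; exact: leq_trans ji (ltn_ord i).
rewrite /raise_at_gaps (eq_pick (Q := fun i : 'I_n.+1 => gap_pos w' i == n)).
  case: pickP => [i /eqP wi|_]; last by rewrite ww'.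
  by apply: running_max_agree; rewrite posE wi.
by move=> i /=; rewrite posE.
Qed.

Lemma raise_at_gaps_pos w i : raise_at_gaps w (gap_pos w i) = running_max w i.
Proof.
rewrite /raise_at_gaps; case: pickP => [j /eqP|].
  move=> ji; congr running_max; apply/eqP; rewrite eqn_leq.
  have kmono := strict_mono_leq (gap_pos_lt w).
  by rewrite -(kmono j i) -(kmono i j) ji leqnn.
have ile : (i < (gap_pos w i).+1)%N.
  by rewrite ltnS strict_mono_ge_id// => j; exact: gap_pos_lt.
by move/(_ (Ordinal ile)); rewrite eqxx.
Qed.

Lemma range_raise_at_gaps : range raise_at_gaps = L X.
Proof.
apply/seteqP; split=> [_ [w _ <-]|y [k kS yk]].
  exists (gap_pos w) => i; first exact: gap_pos_lt.
  by rewrite !raise_at_gaps_pos /= le_max lexx.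
(* The gaps are chosen to give back [k]. Since [y] is already nondecreasing along [k], the running
   maximum changes nothing. *)
pose w n := (y n, if n is m.+1 then (k n - (k m).+1)%N else k 0).
have wk i : gap_pos w i = k i.
  by elim: i => //= i ->; rewrite -addSn subnKC.
have wm i : running_max w i = y (k i).
  by elim: i => [|i]; rewrite /running_max -/running_max wk// => -> /=; exact: max_r.
exists w => //; apply/funext => n; rewrite /raise_at_gaps.
by case: pickP => // i; rewrite wk wm => /eqP ->.
Qed.

Lemma analytic_L (R : realType) : countable [set: X] -> analytic R (L X).
Proof.
move=> cX; exists (seq_space (X * nat)%type); split.
  by apply: polish_seq_space; apply: (countable_prod cX); exact: countableP.
exists raise_at_gaps; [exact: raise_at_gaps_continuous|exact: range_raise_at_gaps].
Qed.

End LAnalytic.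

(** * The Suslin operation and its reduction to [L X] *)

(* Finite sequences are stored with their last entry first, so that the
   children of a node [s] are the lists [i :: s]. *)
Fixpoint branch (z : nat -> nat) (n : nat) : seq nat :=
  if n is m.+1 then z m :: branch z m else [::].

Definition suslin (Y : Type) (F : seq nat -> set Y) : set Y :=
  [set y | exists z, forall n, F (branch z n) y].

Lemma size_branch z n : size (branch z n) = n.
Proof. by elim: n => //= n ->. Qed.

Lemma injective_unbounded (p : nat -> nat) : injective p ->
  forall n N, exists2 m, (n < m)%N & (N < p m)%N.
Proof.
move=> pinj n N; apply: contrapT => bnd.
have pN (i : 'I_N.+2) : (p (n.+1 + i) < N.+1)%N.
  rewrite ltnNge; apply/negP => pN; apply: bnd.
  by exists (n.+1 + i)%N; rewrite // addSn ltnS leq_addr.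
have /leq_card : injective (fun i => Ordinal (pN i)).
  by move=> i j /(congr1 val)/pinj/addnI/val_inj.
by rewrite !card_ord ltnn.
Qed.

(** The [pickle] codes of the nodes along a branch need not increase; this thins the branch until
    they do. *)
Lemma injective_increasing_subseq (p : nat -> nat) : injective p ->
  exists k : nat -> nat,
    (forall i, (k i < k i.+1)%N) /\ (forall i, (p (k i) < p (k i.+1))%N).
Proof.
move=> /injective_unbounded pinf.
have /choice[h hP] n : exists m, (n < m)%N /\ (p n < p m)%N.
  by have [m] := pinf n (p n); exists m.
by exists (fun i => iter i h 0); split=> i; have [] := hP (iter i h 0).
Qed.

Lemma nonincreasing_stationary (u : nat -> nat) (N : nat) :
  (forall n, (N <= n)%N -> (u n.+1 <= u n)%N) ->
  exists M, (N <= M)%N /\ forall n, (M <= n)%N -> u n = u M.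
Proof.
move=> uS; have uN k n : (N <= k)%N -> (k <= n)%N -> (u n <= u k)%N.
  move=> Nk; elim: n => [|n IHn]; first by rewrite leqn0 => /eqP ->.
  rewrite leq_eqVlt => /orP[/eqP ->//|]; rewrite ltnS => kn.
  by apply: leq_trans (IHn kn); apply/uS/(leq_trans Nk).
have ex : exists v, `[< exists2 M, (N <= M)%N & u M = v >].
  by exists (u N); apply/asboolP; exists N.
case: (ex_minnP ex) => v /asboolP[M NM <-] vmin.
exists M; split => // n Mn; apply/eqP; rewrite eqn_leq uN//=.
by apply: vmin; apply/asboolP; exists n => //; exact: leq_trans NM Mn.
Qed.

Section DenseOrder.
Variables (d : Order.disp_t) (X : orderType d) (D : set X).
Hypothesis Ddense : order_dense D.
Local Open Scope order_scope.
Local Open Scope classical_set_scope.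

(* Node [s] of the tree of finite sequences receives the interval
   [(lo s, hi s)]; the intervals of its children are disjoint, contained in it,
   and move to the left.  The fillers decrease below all of them. *)
Lemma tree_intervals : exists (lo hi : seq nat -> X) (filler : nat -> X),
  [/\ forall s, lo s < hi s,
      forall s i, lo s < lo (i :: s) /\ hi (i :: s) <= hi s,
      forall s i j, (i < j)%N -> hi (j :: s) <= lo (i :: s),
      forall m n, (m < n)%N -> filler n < filler m &
      forall n s, filler n < lo s].
Proof.
have [[a [b [Da Db /eqP ab]]] Dd] := Ddense.
wlog {ab} ab : a b Da Db / a < b.
  by move: ab; rewrite neq_lt => /orP[] ab; apply; [| |exact: ab| | |exact: ab].
have /choice[mid midP] (p : X * X) : exists c, D p.1 -> D p.2 -> p.1 < p.2 ->
    D c /\ p.1 < c < p.2.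
  case: p => x y /=; have [[Dx [Dy xy]]|nxy] := pselect (D x /\ D y /\ x < y).
    by have [c] := Dd x y Dx Dy xy; exists c.
  by exists x => Dx Dy xy; case: nxy.
(* The cuts descend strictly from [y] towards [x] inside [D]; consecutive ones will bound the
   children of a node. *)
pose cut := fix cut x y i := if i is j.+1 then mid (x, cut x y j) else mid (x, y).
have cutP x y i : D x -> D y -> x < y -> [/\ D (cut x y i), x < cut x y i & cut x y i < y].
  move=> Dx Dy xy; elim: i => [|i [Dc xc cy]].
    by have /= [//|//|//|? /andP[]] := midP (x, y).
  have /= [//|//|//|? /andP[? ci]] := midP (x, cut x y i); split => //.
  exact: lt_trans ci cy.
have cut_lt x y i j : D x -> D y -> x < y -> (i < j)%N -> cut x y j < cut x y i.
  move=> Dx Dy xy; elim: j => // j IHj; rewrite ltnS => ij.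
  have [Dc xc _] := cutP x y j Dx Dy xy.
  have /= [//|//|//|_ /andP[_ cj]] := midP (x, cut x y j).
  move: ij; rewrite leq_eqVlt => /orP[/eqP -> //|/IHj]; exact: lt_trans.
(* The tree is placed between [m] and [b], the fillers between [a] and [m]. *)
pose m := mid (a, b).
have /= [//|//|//|Dm /andP[am mb]] := midP (a, b).
pose itv := fix itv s := if s is i :: t then
  (cut (itv t).1 (itv t).2 i.+1, cut (itv t).1 (itv t).2 i) else (m, b).
have itvP s : [/\ D (itv s).1, D (itv s).2, (itv s).1 < (itv s).2 & m <= (itv s).1].
  elim: s => [//|i s [Dl Dh lh ml]] /=.
  have [Dc lc _] := cutP _ _ i.+1 Dl Dh lh; have [Dc' _ _] := cutP _ _ i Dl Dh lh.
  by split => //; [exact: (cut_lt (itv s).1 (itv s).2 i i.+1)|exact/ltW/(le_lt_trans ml)].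
exists (fst \o itv), (snd \o itv), (cut a m); split => /=.
- by move=> s; have [] := itvP s.
- move=> s i; have [Dl Dh lh _] := itvP s.
  have [_ lc _] := cutP _ _ i.+1 Dl Dh lh; have [_ _ /ltW] := cutP _ _ i Dl Dh lh.
  by [].
- move=> s i j; have [Dl Dh lh _] := itvP s.
  rewrite leq_eqVlt => /orP[/eqP <-//|ij].
  exact/ltW/(cut_lt (itv s).1 (itv s).2 i.+1 j).
- by move=> i j; exact: cut_lt.
- move=> n s; have [_ _ _ ml] := itvP s; have [_ _ cm] := cutP a m n Da Dm am.
  exact: lt_le_trans cm ml.
Qed.

(** Suppose almost all [t n] extend [s]. By injectivity almost all extend it properly, each through
    some child. The index of that child cannot grow, since moving left would lower [lo]; it is
    eventually constant and yields the next node. *)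
Lemma infinite_branch (lo hi : seq nat -> X) (t : nat -> seq nat) :
  (forall s, lo s < hi s) ->
  (forall s i, lo s < lo (i :: s) /\ hi (i :: s) <= hi s) ->
  (forall s i j, (i < j)%N -> hi (j :: s) <= lo (i :: s)) ->
  injective t -> (forall n, lo (t n) <= lo (t n.+1)) ->
  exists z, forall n, exists m u, t m = u ++ branch z n.
Proof.
move=> lohi nested left tinj tS.
have sub s u : lo s <= lo (u ++ s) /\ hi (u ++ s) <= hi s.
  elim: u => [|i u [los his]] //=; have [lo_ hi_] := nested (u ++ s) i.
  by split; [exact/ltW/(le_lt_trans los)|exact: le_trans hi_ his].
pose P s := exists N, forall n, (N <= n)%N -> exists u, t n = u ++ s.
have step s : P s -> exists i, P (i :: s).
  move=> [N0 N0P].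
  have [N NP] : exists N, forall n, (N <= n)%N -> exists i u, t n = u ++ i :: s.
    have [N1 N1P] : exists N, forall n, (N <= n)%N -> t n <> s.
      have [[m tm]|nt] := pselect (exists m, t m = s).
        by exists m.+1 => n + tn; rewrite -tm in tn; rewrite (tinj _ _ tn) ltnn.
      by exists 0 => n _ tn; apply: nt; exists n.
    exists (maxn N0 N1) => n; rewrite geq_max => /andP[/N0P[u tu] /N1P].
    by case/lastP: u tu => [->//|u i ->] _; exists i, u; rewrite cat_rcons.
  have /choice[idx idxP] n : exists i, (N <= n)%N -> exists u, t n = u ++ i :: s.
    have [/NP[i ti]|] := boolP (N <= n)%N; first by exists i.
    by exists 0.
  have idxS n : (N <= n)%N -> (idx n.+1 <= idx n)%N.
    move=> Nn; rewrite leqNgt; apply/negP => /(left s) lt.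
    have [u tu] := idxP _ Nn; have [v tv] := idxP _ (leqW Nn).
    have := tS n; rewrite leNgt => /negP; apply.
    apply: lt_le_trans (lohi _) _; rewrite tu tv.
    have [_ hv] := sub (idx n.+1 :: s) v; have [lu _] := sub (idx n :: s) u.
    exact: le_trans hv (le_trans lt lu).
  have [M [NM MP]] := nonincreasing_stationary idxS.
  by exists (idx M), M => n Mn; rewrite -(MP n Mn); apply/idxP/(leq_trans NM).
have /choice[h hP] s : exists i, P s -> P (i :: s).
  by have [/step[i Pi]|] := pselect (P s); [exists i|exists 0].
pose st := fix st n := if n is m.+1 then h (st m) :: st m else [::].
have stP n : P (st n).
  elim: n => [|n IHn]; last exact: hP.
  by exists 0 => n _; exists (t n); rewrite cats0.
have stE n : branch (h \o st) n = st n by elim: n => //= n ->.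
exists (h \o st) => n; rewrite stE; have [N /(_ N (leqnn N)) Nn] := stP n.
by exists N.
Qed.

Lemma borel_prop (Y : topologicalType) (P : Prop) : borel [set _ : Y | P].
Proof.
have [HP|HP] := pselect P.
  by rewrite (_ : [set _ | _] = setT); [exact: borelT|apply/seteqP; split].
by rewrite (_ : [set _ | _] = set0); [exact: borel0|apply/seteqP; split].
Qed.

Lemma suslin_reduction (Y : topologicalType) (F : seq nat -> set Y) :
  countable [set: X] ->
  (forall s, borel (F s)) -> (forall i s, F (i :: s) `<=` F s) ->
  exists2 f : Y -> seq_space X, borel_map f & f @^-1` (L X) = suslin F.
Proof.
move=> cX bF antiF.
have [lo [hi [filler [lohi nested left fillS fill_lo]]]] := tree_intervals.
(* Position [k] tests the node with code [k]; where the test fails or [k] is no code, the filler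
   appears. *)
pose f (y : Y) (k : nat) : X := if @pickle_inv (seq nat) k is Some s then
  if `[< F s y >] then lo s else filler k else filler k.
exists f.
  apply: borel_map_seq_space => // k a; rewrite /f.
  case: pickle_inv => [s|]; last exact: borel_prop.
  rewrite (_ : [set _ | _] = F s `&` [set _ | lo s = a]
                             `|` ~` F s `&` [set _ | filler k = a]).
    have := bF s; have bP := @borel_prop Y.
    by move=> bs; apply: borelU; apply: borelI => //; exact: borelC.
  apply/seteqP; split=> y /=.
    by case: asboolP => ys eqa; [left|right].
  by case: asboolP => ys [] [].
apply/seteqP; split=> y.
  move=> [k kS yS].
  (* A filler is below every earlier entry, so only the first term of the run can be one; hence the
     shift to [k i.+1]. *)
  have node i : exists s, [/\ pickle s = k i.+1, F s y & f y (k i.+1) = lo s].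
    have := yS i; rewrite {2}/f.
    have fill : f y (k i) <= filler (k i.+1) -> False.
      rewrite /f; case: pickle_inv => [s|]; last by rewrite leNgt fillS.
      by case: asboolP => _; rewrite leNgt ?fillS ?fill_lo.
    have := @pickle_invK (seq nat) (k i.+1).
    case E : (pickle_inv (k i.+1)) => [s|] /=; last by move=> _ /fill.
    case: asboolP => [sy ks _|_ _ /fill//]; exists s; split => //.
    by rewrite /f E; case: asboolP.
  have /choice[t tP] := node.
  have [||z zP] := @infinite_branch lo hi t lohi nested left.
  - move=> i j tij; apply/eqP.
    have [ti _ _] := tP i; have [tj _ _] := tP j.
    have : k i.+1 = k j.+1 by rewrite -ti -tj tij.
    move=> kij; rewrite -eqSS eqn_leq -(strict_mono_leq kS i.+1 j.+1).
    by rewrite -(strict_mono_leq kS j.+1 i.+1) kij leqnn.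
  - by move=> i; have [_ _ <-] := tP i; have [_ _ <-] := tP i.+1.
  exists z => n; have [m [u tu]] := zP n.
  have [_ + _] := tP m; rewrite tu.
  by elim: u {tu} => [//|i u IHu] /antiF.
move=> [z zF].
(* Conversely, left endpoints increase along a branch, and the positions are made increasing by
   thinning. *)
have pinj : injective (fun n => pickle (branch z n)).
  move=> m n /(pcan_inj pickleK)/(congr1 size).
  by rewrite !size_branch.
have [k [kS pS]] := injective_increasing_subseq pinj.
exists (fun i => pickle (branch z (k i))) => // i.
rewrite /f !pickleK_inv; case: asboolP => // _; case: asboolP => // _.
have lo_add a b : lo (branch z a) <= lo (branch z (a + b)).
  elim: b => [|b IHb]; first by rewrite addn0.
  rewrite addnS /=; have [/ltW lS _] := nested (branch z (a + b)) (z (a + b)).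
  exact: le_trans IHb lS.
by rewrite -(subnKC (ltnW (kS i))).
Qed.

End DenseOrder.

(** * Analytic sets as results of the Suslin operation on closed sets *)

Lemma polish_hausdorff (R : realType) (T : topologicalType) :
  polish R T -> hausdorff_space T.
Proof.
move=> [_ [M _ [h [h' [hK _ ch _]]]]] p q pq; apply: (can_inj hK).
apply: metric_hausdorff => A B Ap Bq.
by have [x [Ax Bx]] := pq _ _ (ch p _ Ap) (ch q _ Bq); exists (h x).
Qed.

(* [F s] is the closure of the image of an intersection of balls of radii
   [1, 1/2, 1/3, ...] whose centers, in a countable dense set, are listed by
   [s]. *)
Lemma analytic_suslin (R : realType) (Y : topologicalType) (B : set Y) :
  hausdorff_space Y -> analytic R B -> exists F : seq nat -> set Y,
  [/\ forall s, closed (F s), forall i s, F (i :: s) `<=` F s & B = suslin F].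
Proof.
move=> hY [Z [[[D cD dD] [M cM [h [h' [hK h'K ch ch']]]]] [g cg <-]]].
have /countable_injP[f finj] := cD.
pose V i k : set M := [set w | exists2 p, D p /\ f p = k & ball (h p) (i.+1%:R^-1 : R)%R w].
pose U := fix U s : set M := if s is k :: t then U t `&` V (size t) k else setT.
pose F s := closure ((g \o h') @` U s).
have UF i s : F (i :: s) `<=` F s.
  by apply: closure_subset; apply: image_subset => w [].
have Ubranch z n N : (N < n)%N -> U (branch z n) `<=` V N (z N).
  elim: n => // n IHn; rewrite ltnS leq_eqVlt => /orP[/eqP ->|/IHn UV] w [Uw].
    by rewrite size_branch.
  by move=> _; exact: UV.
exists F; split => // [s|]; first exact: closed_closure.
apply/seteqP; split => [_ [x _ <-]|y [z zF]].
  have /choice[z zP] i : exists k, V i k (h x).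
    have := dD (h @^-1` (ball (h x) (i.+1%:R^-1 : R)%R)^°).
    case.
    - by exists x; apply: nbhsx_ballx; rewrite invr_gt0.
    - by apply: open_comp => [w _|]; [exact: ch|exact: open_interior].
    - move=> p [/interior_subset xp Dp]; exists (f p), p => //.
      exact: ball_sym.
  exists z => n; apply: subset_closure; exists (h x); last by rewrite /= hK.
  by elim: n => //= n Un; split => //; rewrite size_branch.
(* The sets along the branch shrink, so points chosen in them form a Cauchy sequence; its limit is
   mapped to [y]. *)
have /choice[w wU] n : exists w, U (branch z n) w.
  by have [_ [[w Uw _] _]] := zF n setT filterT; exists w.
have wV N n : (N < n)%N -> V N (z N) (w n) by move=> /Ubranch; apply.
have cauchyw : cauchy (w @ \oo).
  apply: cauchy_exP => e e0; have [N Ne] := inv_nat_lt e0.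
  have [p [Dp fp] _] := wV N N.+1 (ltnSn N); exists (h p), N.+1 => // n /= Nn.
  have [q [Dq fq]] := wV N n Nn.
  have -> : q = p by apply: finj; rewrite ?inE// fq fp.
  by apply: le_ball; exact: ltW.
have [x wx] := cM _ _ cauchyw; exists (h' x) => //.
(* Otherwise disjoint open sets separate [y] from the image of [x]. By continuity a ball about [x]
   is sent into one of them, but for large [n] it contains [U (branch z n)], whose image meets the
   other. The radius is spent as [e / 2] from [x] to [w n], then [e / 4] to the common center and
   [e / 4] to [v]. *)
apply: contrapT => /eqP; move: hY; rewrite open_hausdorff => /[apply].
move=> [[A C] /= [/set_mem Ax /set_mem Cy] [oA oC AC0]].
have /nbhs_ballP[e /= e0 eA] : nbhs x ((g \o h') @^-1` A).
  apply: (@continuous_comp _ _ _ h' g); [exact: ch'|exact: cg|].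
  exact: open_nbhs_nbhs.
have e4 : (0 < e / 4)%R by rewrite divr_gt0.
have [N Ne] := inv_nat_lt e4.
have [n0 _ n0P] : \forall n \near \oo, ball x (e / 2)%R (w n).
  by apply: wx; apply: nbhsx_ballx; rewrite divr_gt0.
pose n := maxn n0 N.+1.
have xwn : ball x (e / 2)%R (w n) by apply: n0P; rewrite /= leq_maxl.
have Nn : (N < n)%N by rewrite leq_maxr.
have [_ [[v Uv <-] Cv]] : ((g \o h') @` U (branch z n)) `&` C !=set0.
  by apply: (zF n); apply: open_nbhs_nbhs.
suff xv : ball x e v.
  have : (A `&` C) (g (h' v)) by split => //; exact: (eA _ xv).
  by move/eqP: AC0 => ->.
have [p [Dp fp] pw] := wV _ _ Nn; have [q [Dq fq] qv] := Ubranch _ _ _ Nn _ Uv.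
have qp : q = p by apply: finj; rewrite ?inE// fq fp.
rewrite {}qp in qv.
have -> : e = (e / 2 + (e / 4 + e / 4))%R by lra.
apply: ball_triangle xwn _; apply: (@ball_triangle _ _ (h p)).
  by apply: ball_sym; apply: le_ball pw; exact: ltW.
by apply: le_ball qv; exact: ltW.
Qed.

(** * [L X] is Borel when [X] has no dense subset *)

Lemma infinitely_often_subseq (P : nat -> Prop) :
  (forall n, exists2 m, (n < m)%N & P m) ->
  exists k : nat -> nat, (forall i, (k i < k i.+1)%N) /\ forall i, P (k i).
Proof.
move=> Pio; have /choice[h hP] n : exists m, (n < m)%N /\ P m.
  by have [m] := Pio n; exists m.
exists (fun i => iter i.+1 h 0); split=> i; [exact: (hP _).1|exact: (hP _).2].
Qed.

Section Scattered.
Variables (d : Order.disp_t) (X : orderType d).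
Hypothesis cX : countable [set: X].
Implicit Types (S T : set X) (x y : X) (u : seq_space X).
Local Open Scope order_scope.
Local Open Scope classical_set_scope.

Definition L_in S : set (seq_space X) := [set u : nat -> X | exists k : nat -> nat,
  [/\ forall i, (k i < k i.+1)%N, forall i, S (u (k i)) &
      forall i, u (k i) <= u (k i.+1)]].

(* Quantifying over the subsets of [S] makes this an ideal of sets. *)
Definition borel_below S := forall T, T `<=` S -> borel (L_in T).

Lemma borel_below_sub S T : borel_below T -> S `<=` T -> borel_below S.
Proof. by move=> bT ST A /subset_trans/(_ ST)/bT. Qed.

Lemma borel_coord n S : borel [set u : seq_space X | S (u n)].
Proof.
apply: borel_open; apply/open_seq_spaceP => u Su; exists n.+1 => v uv.
by rewrite /= -uv.
Qed.

Lemma borel_infinitely_often S :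
  borel [set u : seq_space X | forall n, exists2 m, (n < m)%N & S (u m)].
Proof.
rewrite (_ : [set _ | _] = \bigcap_n \bigcup_m [set u | (n < m)%N /\ S (u m)]).
  apply: borel_bigcap => // n; apply: borel_bigcup => // m.
  by apply: (@borelI _ [set _ | (n < m)%N]); [exact: borel_prop|exact: borel_coord].
apply/seteqP; split=> u uS n; first by have [m] := uS n; exists m.
by have [m _ []] := uS n Logic.I; exists m.
Qed.

(** Either infinitely many terms of the subsequence lie in [S], or a tail of it lies in [T]. *)
Lemma L_in_setU S T : L_in (S `|` T) = L_in S `|` L_in T.
Proof.
apply/seteqP; split=> u.
  move=> [k [kS uST uk]].
  have subseq (j : nat -> nat) (Q : set X) : (forall i, (j i < j i.+1)%N) ->
      (forall i, Q (u (k (j i)))) -> L_in Q u.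
    move=> jS Qj; exists (k \o j); split => // i /=.
      by rewrite (leqW_mono (strict_mono_leq kS)).
    have /nondecreasing_seqP := uk; apply; exact/ltnW.
  have [io|] := pselect (forall n, exists2 m, (n < m)%N & S (u (k m))).
    by have [j [jS Sj]] := infinitely_often_subseq io; left; exact: subseq Sj.
  move=> /existsNP[N NS]; right; apply: (subseq (addn N.+1)) => i.
    by rewrite addnS.
  have [Su|//] := uST (N.+1 + i)%N.
  by case: NS; exists (N.+1 + i)%N => //; rewrite addSn ltnS leq_addr.
by move=> [] [k [kS uS uk]]; exists k; split=> // i; [left|right].
Qed.

Lemma borel_below_setU S T :
  borel_below S -> borel_below T -> borel_below (S `|` T).
Proof.
move=> bS bT A AST; rewrite (_ : A = (A `&` S) `|` (A `&` T)).
  rewrite L_in_setU; apply: borelU; [apply: bS|apply: bT]; exact: subIsetr.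
by rewrite -setIUr; apply/esym/setIidPl.
Qed.

Lemma borel_below_set1 x : borel_below [set x].
Proof.
move=> T Tx.
rewrite (_ : L_in T =
    [set u | forall n, exists2 m, (n < m)%N & T (u m)]).
  exact: borel_infinitely_often.
apply/seteqP; split=> u.
  move=> [k [kS uT _]] n; exists (k n.+1) => //.
  exact: strict_mono_ge_id.
move=> /infinitely_often_subseq[k [kS Tk]]; exists k; split => // i.
by rewrite (Tx _ (Tk i)) (Tx _ (Tk i.+1)).
Qed.

(** The first term of a nondecreasing subsequence bounds the others from below and ranges over a
    countable set. *)
Lemma borel_below_lower S :
  (forall x, S x -> borel_below (S `&` [set y | x <= y])) -> borel_below S.
Proof.
move=> bS T TS.
rewrite (_ : L_in T = \bigcup_x [set u | S x /\ L_in (T `&` [set y | x <= y]) u]).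
  apply: borel_bigcup => // x; have [Sx|nSx] := pselect (S x).
    rewrite (_ : [set _ | _] = L_in (T `&` [set y | x <= y])).
      by apply: (bS x) => //; exact: setSI.
    by apply/seteqP; split=> u => [[]|].
  by rewrite (_ : [set _ | _] = set0); [exact: borel0|apply/seteqP; split=> u []].
apply/seteqP; split=> u; last first.
  by move=> [x _ [_ [k [kS uk ku]]]]; exists k; split=> // i; have [] := uk i.
move=> [k [kS uT uk]]; exists (u (k 0)) => //; split; first exact/TS/uT.
by exists k; split=> // i; split=> //=; have /nondecreasing_seqP := uk; apply.
Qed.

(* A nondecreasing subsequence in [T] without upper bound in [S] exists as soon
   as [u] visits every final segment of [T] infinitely often. *)
Lemma borel_below_upper S :
  (forall x, S x -> borel_below (S `&` [set y | y <= x])) -> borel_below S.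
Proof.
move=> bS T TS.
(* The first condition excludes an empty [T], for which the second is vacuous. *)
pose cofinal := [set u : seq_space X | exists n, T (u n)] `&`
  \bigcap_x [set u : seq_space X | T x ->
    forall n, exists2 m, (n < m)%N & T (u m) /\ x <= u m].
rewrite (_ : L_in T =
    \bigcup_x [set u | S x /\ L_in (T `&` [set y | y <= x]) u] `|` cofinal).
  apply: borelU.
    apply: borel_bigcup => // x; have [Sx|nSx] := pselect (S x).
      rewrite (_ : [set _ | _] = L_in (T `&` [set y | y <= x])).
        by apply: (bS x) => //; exact: setSI.
      by apply/seteqP; split=> u => [[]|].
    by rewrite (_ : [set _ | _] = set0); [exact: borel0|apply/seteqP; split=> u []].
  apply: borelI.
    rewrite (_ : [set _ | _] = \bigcup_n [set u | T (u n)]).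
      by apply: borel_bigcup => // n; exact: borel_coord.
    by apply/seteqP; split=> u => [[n Tn]|[n _ Tn]]; exists n.
  apply: borel_bigcap => // x.
  have [Tx|nTx] := pselect (T x); last first.
    by rewrite (_ : [set _ | _] = setT); [exact: borelT|apply/seteqP; split=> // u _ /nTx].
  rewrite (_ : [set _ | _] =
    [set u | forall n, exists2 m, (n < m)%N & (T `&` [set y | x <= y]) (u m)]).
    exact: borel_infinitely_often.
  by apply/seteqP; split=> u; [move/(_ Tx)|move=> + _].
apply/seteqP; split=> u.
  move=> [k [kS uT uk]].
  have [[x [Sx ux]]|nbnd] := pselect (exists x, S x /\ forall i, u (k i) <= x).
    by left; exists x => //; split => //; exists k; split => // i; split => /=.
  right; split; first by exists (k 0).
  move=> x _ Tx n.
  have [i xi] : exists i, x < u (k i).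
    apply: contrapT => nx; apply: nbnd; exists x; split; first exact: TS.
    by move=> i; rewrite leNgt; apply/negP => xu; apply: nx; exists i.
  exists (k (maxn i n.+1)).
    by apply: leq_trans (strict_mono_ge_id kS _); rewrite leq_maxr.
  split => //; apply: le_trans (ltW xi) _.
  by have /nondecreasing_seqP := uk; apply; rewrite /= leq_maxl.
move=> [[x _ [_ [k [kS uk ku]]]]|[[n0 Tn0] io]].
  by exists k; split=> // i; have [] := uk i.
have /choice[h hP] m : exists m', T (u m) -> [/\ (m < m')%N, T (u m') & u m <= u m'].
  have [Tm|] := pselect (T (u m)); last by exists 0.
  by have [m' mm' [Tm' le]] := io (u m) Logic.I Tm m; exists m'.
have Titer i : T (u (iter i h n0)) by elim: i => //= i /hP[].
by exists (fun i => iter i h n0); split=> // i; have [] := hP _ (Titer i).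
Qed.

Let itv x y : set X := [set z | x <= z <= y].
(** One of the two intervals has at most one point, so the conjunction makes the relation symmetric
    without comparing [x] and [y]. *)
Let sim x y := borel_below (itv x y) /\ borel_below (itv y x).

Let itv_split x y z : itv x z `<=` itv x y `|` itv y z.
Proof.
move=> w /andP[xw wz]; rewrite /itv/= xw wz andbT /=.
by case: (leP w y) => [|/ltW]; [left|right].
Qed.

Let sim_sym x y : sim x y -> sim y x. Proof. by case. Qed.

Let sim_trans y x z : sim x y -> sim y z -> sim x z.
Proof.
by move=> [xy yx] [yz zy]; split;
  apply: (borel_below_sub _ (@itv_split _ y _)); exact: borel_below_setU.
Qed.

Let itv_ge x y : x <= y -> itv y x `<=` [set x].
Proof.
move=> xy z /andP[yz zx]; apply/eqP.
by rewrite eq_le zx (le_trans xy).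
Qed.

(* If the classes of [sim] were not densely ordered, two adjacent ones could be
   merged. *)
Lemma scattered_borel_L : ~ (exists D : set X, order_dense D) -> borel (L X).
Proof.
move=> nD; suff allsim x y : sim x y.
  rewrite (_ : L X = L_in setT).
    apply: (_ : borel_below setT) => //.
    apply: borel_below_lower => x _; apply: borel_below_upper => y _.
    have [bxy _] := allsim x y.
    by apply: borel_below_sub bxy _ => z [[_ /= xz] zy]; exact/andP.
  by apply/seteqP; split=> u => [[k kS uk]|[k [kS _ uk]]]; exists k.
apply: contrapT => nxy; apply: nD.
have sim_refl z : sim z z.
  by split; apply: borel_below_sub (@borel_below_set1 z) _; exact: itv_ge.
(* The choice depends only on the class, so equivalent points share their representative. The
   default [x] is never taken, as [z] is in its own class. *)
pose rep z := xget x [set w | sim z w].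
have rep_sim z : sim z (rep z).
  by apply: (@xgetPex _ x [set w | sim z w]); exists z; exact: sim_refl.
have rep_eq z w : sim z w -> rep z = rep w.
  move=> zw; congr xget; apply/seteqP; split=> v /= => [zv|].
    exact: sim_trans (sim_sym zw) zv.
  exact: sim_trans.
exists (range rep); split.
  exists (rep x), (rep y); split; [by exists x|by exists y|] => rxy.
  by apply: nxy; apply: sim_trans (rep_sim x) _; rewrite rxy; exact/sim_sym/rep_sim.
move=> a b [a' _ ra] [b' _ rb] ab; apply: contrapT => nc.
suff /rep_eq : sim a b.
  have <- : rep a' = rep a by apply: rep_eq; rewrite -ra.
  have <- : rep b' = rep b by apply: rep_eq; rewrite -rb.
  by rewrite ra rb => eab; rewrite eab ltxx in ab.
have bge v w : v <= w -> borel_below (itv w v).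
  by move=> vw; apply: borel_below_sub (@borel_below_set1 v) _; exact: itv_ge.
split; last exact: (bge a b (ltW ab)).
(* No representative lies strictly between [a] and [b]. If that of [z] is at most [a], the interval
   from [a] to [z] lies inside the one from [rep z] to [z], so [z] is in [A]; otherwise [z] is in
   [B]. *)
pose A := itv a b `&` [set z | borel_below (itv a z)].
pose B := itv a b `&` [set z | borel_below (itv z b)].
apply: (@borel_below_sub _ (A `|` B)); last first.
  move=> z abz; have /andP[az zb] := abz.
  have [zr rz] := rep_sim z.
  have [rza|arz] := leP (rep z) a.
    left; split => //=; apply: borel_below_sub rz _ => w /andP[aw wz].
    by rewrite /itv/= wz (le_trans rza).
  have [brz|rzb] := leP b (rep z); last first.
    by case: nc; exists (rep z); [exists z|rewrite arz].
  right; split => //=; apply: borel_below_sub zr _ => w /andP[zw wb].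
  by rewrite /itv/= zw (le_trans wb).
apply: borel_below_setU.
  apply: borel_below_upper => z [_ az]; apply: borel_below_sub az _.
  by move=> w [[/andP[aw _] _] /= wz]; apply/andP.
apply: borel_below_lower => z [_ zb]; apply: borel_below_sub zb _.
by move=> w [[/andP[_ wb] _] /= zw]; apply/andP.
Qed.

End Scattered.

(** * A Suslin set that is not Borel *)

Lemma branch_agree (x y : nat -> nat) n : branch x n = branch y n <-> agree n x y.
Proof.
elim: n => [|n IHn] /=; first by split.
split=> [[xyn /IHn xy] i|xy].
  by rewrite ltnS leq_eqVlt => /orP[/eqP ->//|/xy].
by rewrite xy//; congr (_ :: _); apply/IHn => i /leqW; exact: xy.
Qed.

Definition closed_relation (C : (nat -> nat) -> (nat -> nat) -> Prop) :=
  forall x z, ~ C x z ->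
  exists n, forall x' z', agree n x x' -> agree n z z' -> ~ C x' z'.

(** These are the analytic subsets of Baire space in their classical form. *)
Definition closed_projection (A : set (seq_space nat)) :=
  exists2 C, closed_relation C & A = [set x | exists z, C x z].

Lemma agree_leq (X : Type) m n (x y : nat -> X) :
  (m <= n)%N -> agree n x y -> agree m x y.
Proof. by move=> mn xy i im; apply: xy; exact: leq_trans im mn. Qed.

Lemma closed_projection_open (U : set (seq_space nat)) :
  open U -> closed_projection U.
Proof.
move=> /open_seq_spaceP oU.
(* The witness [z 0] is the length of a cylinder around [x] inside [U]. *)
exists (fun x z => forall y, agree (z 0) x y -> U y).
  move=> x z nU; exists (z 0).+1 => x' z' xx' zz'; apply: contra_not nU => x'U y xy.
  apply: x'U => i; rewrite -(zz' 0 isT) => iz.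
  by rewrite -xx' ?leqW//; exact: xy.
apply/seteqP; split=> [x /oU[n nU]|x [z]]; first by exists (fun=> n).
by apply.
Qed.

Lemma closed_projection_closed (A : set (seq_space nat)) :
  closed A -> closed_projection A.
Proof.
rewrite -openC => /open_seq_spaceP oA; exists (fun x _ => A x).
  by move=> x z /oA[n nA]; exists n => x' z' /nA.
by apply/seteqP; split=> x => [Ax|[]//]; exists id.
Qed.

Lemma closed_projection_bigcup (A : nat -> set (seq_space nat)) :
  (forall i, closed_projection (A i)) -> closed_projection (\bigcup_i A i).
Proof.
move=> pA; have /choice[C CP] i : exists C, closed_relation C /\
    A i = [set x | exists z, C x z] by have [C] := pA i; exists C.
(* The first entry of the witness selects the index of the union. *)
exists (fun x z => C (z 0) x (fun j => z j.+1)).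
  move=> x z /(CP (z 0)).1[n nC]; exists n.+1 => x' z' xx' zz'.
  rewrite -zz'//; apply: nC => [i /leqW|i]; first exact: xx'.
  exact: zz' i.+1.
apply/seteqP; split=> x.
  move=> [i _]; rewrite (CP i).2 => -[z zC].
  by exists (fun j => if j is k.+1 then z k else i).
by move=> [z zC]; exists (z 0) => //; rewrite (CP (z 0)).2; exists (fun j => z j.+1).
Qed.

Lemma closed_projection_bigcap (A : nat -> set (seq_space nat)) :
  (forall i, closed_projection (A i)) -> closed_projection (\bigcap_i A i).
Proof.
move=> pA; have /choice[C CP] i : exists C, closed_relation C /\
    A i = [set x | exists z, C x z] by have [C] := pA i; exists C.
(* One [z] carries the witnesses for all [i], interleaved by the coding of pairs. *)
exists (fun x z => forall i, C i x (fun j => z (pickle (i, j)))).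
  move=> x z /existsNP[i /(CP i).1[n nC]].
  (* Long enough to fix [n] entries of [x] and the first [n] entries of the witness for [i]. *)
  exists (n + \max_(j < n) (pickle (i, j : nat)).+1)%N => x' z' xx' zz' C'.
  apply: nC (C' i).
    by move=> j jn; apply: xx'; rewrite ltn_addr.
  move=> j jn; apply: zz'; apply: leq_trans (leq_addl _ _).
  exact: (leq_bigmax (Ordinal jn)).
apply/seteqP; split=> x.
  move=> xA; have /choice[z zP] i : exists z, C i x z.
    by have := xA i Logic.I; rewrite (CP i).2.
  exists (fun k => if unpickle k is Some (i, j) then z i j else 0) => i.
  rewrite (_ : (fun _ => _) = z i)//.
  by apply/funext => j; rewrite pickleK.
by move=> [z zC] i _; rewrite (CP i).2; exists (fun j => z (pickle (i, j))).
Qed.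

(** The sets that are closed projections together with their complements form a sigma-algebra
    containing the open sets. *)
Lemma borel_closed_projection (A : set (seq_space nat)) :
  borel A -> closed_projection A.
Proof.
move=> bA.
suff [] : [set B | closed_projection B /\ closed_projection (~` B)] A by [].
apply: smallest_sub bA => [|U oU]; last first.
  split; first exact: closed_projection_open.
  by apply: closed_projection_closed; exact: open_closedC.
split=> [|B [pB pBC]|B pB].
- by split; [apply: closed_projection_open; exact: open0|
    rewrite setC0; apply: closed_projection_open; exact: openT].
- by rewrite /= setTD setCK.
- split; first by apply: closed_projection_bigcup => i; have [] := pB i.
  by rewrite setC_bigcup; apply: closed_projection_bigcap => i; have [] := pB i.
Qed.

(* A point [x] is read as the code of a closed relation, so that [suslin
   self_coded] consists of the [x] that belong to the projection coded by [x]. *)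
Fixpoint self_coded (s : seq nat) : set (seq_space nat) :=
  [set x : nat -> nat | x (pickle (branch x (size s), s)) = 0] `&`
  (if s is _ :: t then self_coded t else setT).

Lemma self_coded_branch z n (x : seq_space nat) : self_coded (branch z n) x <->
  forall m, (m <= n)%N -> x (pickle (branch x m, branch z m)) = 0.
Proof.
elim: n => [|n [IHn IHn']].
  by split=> [[x0 _] m|x0]; [rewrite leqn0 => /eqP ->|split=> //; exact: x0].
split=> [[xn /IHn xs] m|xs].
  rewrite leq_eqVlt => /orP[/eqP ->|/xs//].
  by move: xn; rewrite /= size_branch.
split; last by apply: IHn' => m /leqW; exact: xs.
by have := xs n.+1 (leqnn _); rewrite /= size_branch.
Qed.

Lemma borel_self_coded s : borel (self_coded s).
Proof.
have bG (t : seq nat) :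
    borel [set x : seq_space nat | x (pickle (branch x (size t), t)) = 0].
  apply: borel_open; apply/open_seq_spaceP => x /= x0.
  pose k := pickle (branch x (size t), t); exists (size t + k.+1)%N => y xy.
  have <- : branch x (size t) = branch y (size t).
    by apply/branch_agree; apply: agree_leq xy; exact: leq_addr.
  by rewrite -xy// addnS ltnS leq_addl.
elim: s => [|i s IHs]; apply: borelI => //; exact: borelT.
Qed.

(** Otherwise the complement would be the projection of a closed [C], and a point coding [C] would
    belong to the set exactly when it does not. *)
Lemma suslin_self_coded_not_borel : ~ borel (suslin self_coded).
Proof.
move=> /borelC/borel_closed_projection[C clC SC].
pose P (s t : seq nat) := exists x z,
  [/\ branch x (size s) = s, branch z (size t) = t & C x z].
(* [x] vanishes at the code of [(s, t)] exactly when some point of [C] extends both. As [C] is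
   closed, passing all tests along [z] amounts to [C x z]. *)
pose x : seq_space nat := fun k =>
  if unpickle k is Some (s, t) then ~~ `[< P s t >] : nat else 0.
have xP z : (forall n, self_coded (branch z n) x) <-> C x z.
  split=> [xz|Cxz n]; last first.
    apply/self_coded_branch => m _; rewrite /x pickleK; apply/eqP.
    rewrite eqb0 negbK; apply/asboolP; exists x, z.
    by rewrite !size_branch.
  apply: contrapT => /clC[n nC].
  have /self_coded_branch/(_ n (leqnn n)) := xz n.
  rewrite {1}/x pickleK => /eqP; rewrite eqb0 negbK => /asboolP[x' [z' []]].
  rewrite !size_branch => /branch_agree xx' /branch_agree zz'.
  by apply: nC => i /[dup]; [move=> /xx'|move=> /zz'].
have [[z zC]|nx] := pselect (exists z, C x z).
  have : (~` suslin self_coded) x by rewrite SC; exists z.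
  by apply; exists z; apply/xP.
have : ~ (~` suslin self_coded) x by rewrite SC.
by apply=> -[z /xP zC]; apply: nx; exists z.
Qed.

(** * The rationals and both directions of the equivalence *)

Lemma order_dense_rat : order_dense [set: rat].
Proof.
split=> [|a b _ _ ab]; first by exists 0%R, 1%R.
by exists ((a + b) / 2)%R => //; rewrite !midf_lt.
Qed.

Lemma not_borel_L_rat : ~ borel (L rat).
Proof.
have [||f bf fL] := suslin_reduction order_dense_rat _ borel_self_coded.
- exact: countableP.
- by move=> i s x [].
by move=> /bf; rewrite fL; exact: suslin_self_coded_not_borel.
Qed.

Theorem theorem3p9 (R : realType) (d : Order.disp_t) (X : orderType d)
  (countableX : countable [set: X]) :
  Sigma11_complete R (L X) <-> exists D : set X, order_dense D.
Proof.
split=> [[_ complete]|[D Ddense]].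
  apply: contrapT => /(scattered_borel_L countableX) bL.
  have cQ : countable [set: rat] by exact: countableP.
  have [f bf fL] := complete _ (polish_seq_space R cQ) _ (analytic_L R cQ).
  by apply: not_borel_L_rat; rewrite -fL; exact: bf.
split=> [|Y pY B aB]; first exact: analytic_L.
have [F [clF antiF ->]] := analytic_suslin (polish_hausdorff pY) aB.
by apply: (suslin_reduction Ddense) => // s; apply: borel_closed; exact: clF.
Qed.
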